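(* Let $X$ be a Tychonoff space and let $T\subseteq X$ be a $C^{*}$-embedded subset of $X$. Then $T$ is $S$-embedded in $X$ if and only if for every $g\in C(X)$ that is bounded away from zero on every hard subset of $T$, the sets $T$ and $Z(g)$ are completely separated in $X$.
   Context: All spaces are Tychonoff (completely regular Hausdorff); subsets carry the subspace topology. $C(Y)$ and $C^{*}(Y)$ denote the rings of continuous real-valued, respectively bounded continuous real-valued, functions on a space $Y$; $\beta Y$ and $\upsilon Y$ denote its Stone-Čech compactification and Hewitt realcompactification ($Y\subseteq \upsilon Y\subseteq\beta Y$). A subset $H\subseteq Y$ is hard in $Y$ (a hard subset of $Y$) if $H$ is closed in $Y\cup K$, where $K=\mathrm{cl}_{\beta Y}(\upsilon Y\setminus Y)$. For a subset $T\subseteq X$, ''hard subset of $T$'' means hard in $T$ with $T$ regarded as a space in its own right. A function in $C(Y)$ is hard-bounded if it is bounded on every hard subset of $Y$. A subset $T\subseteq X$ is $C^{*}$-embedded in $X$ if every function in $C^{*}(T)$ extends to a function in $C(X)$; it is $S$-embedded in $X$ if every hard-bounded continuous function on $T$ extends to a function in $C(X)$. $Z(g)=\{x\in X: g(x)=0\}$ is the zero set of $g\in C(X)$. $g$ is bounded away from zero on a set $H$ if there is $m>0$ with $|g(x)|\ge m$ for all $x\in H$. Two subsets of $X$ are completely separated in $X$ if they are contained in two disjoint zero sets of $X$. *)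

(* Defs.v *)
From HB Require Import structures.
From mathcomp Require Import all_boot all_order all_algebra.
From mathcomp Require Import all_classical all_reals all_analysis.

Set Implicit Arguments.
Unset Strict Implicit.
Unset Printing Implicit Defensive.

Import Order.TTheory GRing.Theory Num.Theory.
Import numFieldNormedType.Exports.

Local Open Scope classical_set_scope.
Local Open Scope ring_scope.

Definition tychonoff_space (X : topologicalType) : Prop :=
  completely_regular_space X /\ hausdorff_space X.

Section StoneCech.
Context (R : realType) (Y : topologicalType).

Definition bounded_continuous : set (Y -> R) :=
  [set f | continuous f /\ bounded_fun f].

Definition cstar_eval (y : Y) : {ptws bounded_continuous -> R} :=
  fun f => set_val f y.

(* beta Y is the closure of the image of Y in the product of copies of R
   indexed by C*(Y); this closure is compact because each coordinate of the
   image is bounded.  See stone_cech_compact, stone_cech_hausdorff,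
   stone_cech_dense, stone_cech_embedding and stone_cech_extend. *)
Definition stone_cech : topologicalType :=
  set_type (closure (range cstar_eval)).

Definition stone_cech_in (y : Y) : stone_cech :=
  exist _ (cstar_eval y)
    (mem_set (subset_closure (imageP cstar_eval (I : [set: Y] y)))).

(* upsilon Y consists of the points p of beta Y such that every f in C(Y)
   extends continuously to the subspace of beta Y made of Y and p; it is the
   largest subspace of beta Y containing Y in which Y is C-embedded, see
   range_realcompactification, realcompactification_extend and
   realcompactification_max. *)
Definition realcompactification : set stone_cech :=
  [set p | forall f : Y -> R, continuous f ->
    exists2 F : stone_cech -> R,
      {within range stone_cech_in `|` [set p], continuous F} &
      forall y, F (stone_cech_in y) = f y].

(* Y is identified with its image in beta Y. *)
Definition hard (H : set Y) : Prop :=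
  let K := closure (realcompactification `\` range stone_cech_in) in
  closed (stone_cech_in @` H : set (subspace (range stone_cech_in `|` K))).

Definition hard_bounded (f : Y -> R) : Prop :=
  forall H : set Y, hard H -> [bounded f y | y in H].

Lemma cstar_eval_continuous : continuous cstar_eval.
Proof.
move=> y; apply/cvg_sup => f.
apply/(continuous_comp_initial
  (w := fun p : forall _ : bounded_continuous, R => p f)).
have [+ _] := set_valP f; exact.
Qed.

Lemma stone_cech_in_continuous : continuous stone_cech_in.
Proof.
exact/(continuous_comp_initial (w := set_val))/cstar_eval_continuous.
Qed.

Lemma coordinate_continuous (f : bounded_continuous) :
  continuous (fun p : stone_cech => set_val p f).
Proof.
move=> p; apply: (@continuous_comp _ _ _
  (set_val : stone_cech -> {ptws bounded_continuous -> R}) (fun q => q f)).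
  exact: initial_continuous.
exact: (@proj_continuous _ (fun=> R)).
Qed.

Lemma stone_cech_hausdorff : hausdorff_space stone_cech.
Proof.
move=> p q pq; apply: val_inj; apply: funext => f.
apply: (@norm_hausdorff _ R) => A B nA nB.
have [z [Az Bz]] := pq _ _ (coordinate_continuous nA) (coordinate_continuous nB).
by exists (set_val z f).
Qed.

Lemma stone_cech_compact : compact [set: stone_cech].
Proof.
have bndM (f : bounded_continuous) :
    exists M : R, forall y, `|set_val f y| <= M.
  have [_ [M [_ bM]]] := set_valP f.
  by exists (M + 1) => y; apply: bM => //; rewrite ltrDl.
have [M leM] := choice bndM.
have cP : compact (closure (range cstar_eval)).
  apply: (@subclosed_compact _ _
    [set p : {ptws bounded_continuous -> R} |
       forall f, `[- M f, M f]%classic (p f)]).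
  - exact: closed_closure.
  - exact: (@tychonoff bounded_continuous (fun=> R)
      (fun f => `[- M f, M f]%classic) (fun=> @segment_compact R _ _)).
  - move=> p clp f; have cl : closed (`[- M f, M f]%classic : set R) by exact: itv_closed.
    apply: (cl (p f)) => B nB.
    have [_ [[y _ <-] By]] :=
      clp _ (@proj_continuous bounded_continuous (fun=> R) f p _ nB).
    exists (set_val f y); split => //=.
    by rewrite in_itv /= -ler_norml.
move=> F PF _.
have PG : ProperFilter (set_val @ F : set_system {ptws bounded_continuous -> R}).
  exact: fmap_proper_filter.
have [|a [aP aF]] := cP _ PG.
  by rewrite /fmap /=; apply: filterS filterT => p _; exact: set_valP.
exists (SigSub (mem_set aP)); split => // A B FA [_ [[U oU <-] /= Ua] UB].
have FA' : (set_val @ F) (set_val @` A).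
  have sA : A `<=` (set_val @^-1` (set_val @` A)) by move=> p Ap; exists p.
  exact: (@filterS _ F _ _ _ sA FA).
have [_ [[p Ap <-] Up]] := aF _ _ FA' (open_nbhs_nbhs (conj oU Ua)).
by exists p; split => //; exact: UB.
Qed.

Lemma stone_cech_dense : closure (range stone_cech_in) = [set: stone_cech].
Proof.
apply/seteqP; split=> // p _ B [_ [[U oU <-] /= Up] UB].
have [_ [[y _ <-] Uy]] := set_valP p _ (open_nbhs_nbhs (conj oU Up)).
by exists (stone_cech_in y); split; [exists y | exact: UB].
Qed.

Lemma stone_cech_extend (f : Y -> R) : continuous f -> bounded_fun f ->
  exists2 F : stone_cech -> R, continuous F &
    forall y, F (stone_cech_in y) = f y.
Proof.
move=> cf bf; pose i : bounded_continuous := SigSub (mem_set (conj cf bf)).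
by exists (fun p => set_val p i) => //; exact: coordinate_continuous.
Qed.

(* stone_cech_in is injective, and Y carries the initial topology for it. *)
Lemma stone_cech_embedding : tychonoff_space Y ->
  injective stone_cech_in /\
  forall U : set Y, open U ->
    exists2 V : set stone_cech, open V & stone_cech_in @^-1` V = U.
Proof.
move=> [crY hY].
have sep x B : closed B -> ~ B x -> exists f : bounded_continuous,
    set_val f x = 0 /\ forall y, B y -> set_val f y = 1.
  move=> cB Bx; have /(uniform_separatorP (R := R))[f [cf f01 f0 f1]] := crY x B cB Bx.
  have bf : bounded_fun f.
    exists 1; split => // e e1 y _; apply: le_trans (ltW e1).
    have /(_ (f y)) := f01; rewrite /= in_itv /= => /(_ (imageP f I))/andP[f0' ?].
    by rewrite ger0_norm.
  pose i : bounded_continuous := SigSub (mem_set (conj cf bf)).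
  exists i; split; first by apply: f0; exists x.
  by move=> y By; apply: f1; exists y.
split.
  move=> x y xy; apply: contrapT => nxy.
  have cy : closed [set y] by exact/accessible_closed_set1/hausdorff_accessible.
  have [f [f0 f1]] := sep x [set y] cy nxy.
  have : set_val f x = set_val f y :=
    congr1 (fun p : stone_cech => set_val p f) xy.
  by rewrite f0 f1// => /eqP; rewrite eq_sym oner_eq0.
move=> U oU.
exists (\bigcup_(f in [set f : bounded_continuous | forall y, ~ U y -> set_val f y = 1])
   (fun p : stone_cech => set_val p f) @^-1` [set r | r < 1]).
  apply: bigcup_open => f _; apply: open_comp; last exact: open_lt.
  by move=> p _; exact: coordinate_continuous.
apply/seteqP; split => y /=.
  move=> [f /= fU fy]; apply: contrapT => /fU f1.
  have : set_val f y < 1 := fy.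
  by rewrite f1 ltxx.
move=> Uy; have [f [f0 f1]] := sep y (~` U) (open_closedC oU) (fun nUy => nUy Uy).
by exists f => //; change (set_val f y < 1); rewrite f0.
Qed.

Lemma realcompactification_max (S : set stone_cech) :
  range stone_cech_in `<=` S ->
  (forall f : Y -> R, continuous f -> exists2 F : stone_cech -> R,
     {within S, continuous F} & forall y, F (stone_cech_in y) = f y) ->
  S `<=` realcompactification.
Proof.
move=> YS ext p Sp f /ext[F cF Ff]; exists F => //.
by apply: continuous_subspaceW cF => q [/YS//|->].
Qed.

Lemma range_realcompactification : tychonoff_space Y ->
  range stone_cech_in `<=` realcompactification.
Proof.
move=> /stone_cech_embedding[inj op] _ [y0 _ <-] f cf.
have ext (p : stone_cech) : exists r : R, forall y, stone_cech_in y = p -> f y = r.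
  have [[y <-]|np] := pselect (exists y, stone_cech_in y = p).
    by exists (f y) => z /inj ->.
  by exists 0 => y yp; case: np; exists y.
have [F Ff] := choice ext.
exists F; last by move=> y; rewrite -(Ff _ y).
apply/subspace_continuousP => p pY B /=.
have {pY}[y <-] : exists y, stone_cech_in y = p.
  by case: pY => [[y _ <-]|->]; [exists y|exists y0].
move=> nB; have : nbhs (f y) B by rewrite (Ff _ y erefl).
move=> /cf; rewrite nbhs_simpl /= nbhsE => -[U [oU Uy] UB].
have [V oV VU] := op U oU.
have Vy : V (stone_cech_in y) by have : U y by []; rewrite -VU.
rewrite /within /=; apply: filterS (open_nbhs_nbhs (conj oV Vy)) => q Vq qY.
have [z zq] : exists y, stone_cech_in y = q.
  by case: qY => [[z _ <-]|->]; [exists z|exists y0].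
have : B (f z) by apply: UB; rewrite -VU /= zq.
by rewrite (Ff q z zq).
Qed.

Lemma realcompactification_extend (f : Y -> R) :
  tychonoff_space Y -> continuous f ->
  exists2 F : stone_cech -> R, {within realcompactification, continuous F} &
    forall y, F (stone_cech_in y) = f y.
Proof.
move=> tY cf.
have ext (p : stone_cech) : exists r : R, realcompactification p ->
    exists F : stone_cech -> R,
    [/\ {within range stone_cech_in `|` [set p], continuous F},
        forall y, F (stone_cech_in y) = f y & F p = r].
  have [/(_ _ cf)[F cF Ff]|] := pselect (realcompactification p); last by exists 0.
  by exists (F p) => _; exists F.
have [F extF] := choice ext.
have near_in (p : stone_cech) (e : R) : realcompactification p -> 0 < e ->
    exists2 U : set stone_cech, open_nbhs p U &
      forall y, U (stone_cech_in y) -> `|F p - f y| < e.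
  move=> Rp e0; have [G [/subspace_continuousP cG Gf GFp]] := extF p Rp.
  have := cG p (or_intror erefl) _ (nbhsx_ballx (G p) e e0).
  rewrite nbhs_simpl /= /within /= nbhsE => -[U oU UG]; exists U => // y Uy.
  have : ball (G p) e (G (stone_cech_in y)) by apply: UG => //; left; exists y.
  by rewrite -ball_normE /= Gf GFp.
exists F; last first.
  move=> y; have Ry := range_realcompactification tY (imageP _ (I : [set: Y] y)).
  by have [G [_ Gf <-]] := extF _ Ry.
apply/subspace_continuousP => p Rp; apply/cvgrPdist_lt => e e0.
have e20 : 0 < e / 2 by rewrite divr_gt0.
have [U oU Uf] := near_in p _ Rp e20.
rewrite /prop_near1 /nbhs /= /within /=.
apply: filterS (open_nbhs_nbhs oU) => q Uq Rq.
have [V [oV Vq] Vf] := near_in q _ Rq e20.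
have : closure (range stone_cech_in) q by rewrite stone_cech_dense.
have nUV : nbhs q (U `&` V).
  by apply: open_nbhs_nbhs; split => //; apply: openI => //; case: oU.
move=> /(_ _ nUV)[_ [[y _ <-] [Uy Vy]]].
rewrite (splitr e) -(subrKA (f y)) (le_lt_trans (ler_normD _ _))// ltrD//.
  exact: Uf.
by rewrite distrC; exact: Vf.
Qed.

End StoneCech.

Section Embeddings.
Context (R : realType) (X : topologicalType).

Definition Cstar_embedded (T : set X) : Prop :=
  forall f : T -> R, continuous f -> bounded_fun f ->
    exists2 g : X -> R, continuous g & forall t : T, g (set_val t) = f t.

Definition S_embedded (T : set X) : Prop :=
  forall f : T -> R, continuous f -> hard_bounded f ->
    exists2 g : X -> R, continuous g & forall t : T, g (set_val t) = f t.

Definition zero_set (g : X -> R) : set X := [set x | g x = 0].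

Definition bounded_away_from_zero (g : X -> R) (A : set X) : Prop :=
  exists2 m : R, 0 < m & forall x, A x -> m <= `|g x|.

Definition completely_separated (A B : set X) : Prop :=
  exists g h : X -> R,
    [/\ continuous g, continuous h, A `<=` zero_set g, B `<=` zero_set h &
        zero_set g `&` zero_set h = set0].

End Embeddings.

(* Main.v *)
Require Import Defs.
From mathcomp Require Import all_boot all_order all_algebra.
From mathcomp Require Import all_classical all_reals all_analysis.
Import Order.TTheory GRing.Theory Num.Theory.
Import numFieldNormedType.Exports.
Local Open Scope classical_set_scope.
Local Open Scope ring_scope.

(** Both directions turn a bound on a function into a bound away from zero.

    If [T] is S-embedded and [g] is bounded away from zero on the hard subsets
    of [T], then [g] has no zero on [T], because points are hard ([hard_set1]),
    and [1 / g] is hard-bounded on [T].  Let [h] extend it to the whole space: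
    the product [g * h] is [1] on [T] and [0] on the zero set of [g], hence
    separates them.

    Conversely, let [f] be hard-bounded on [T].  The homeomorphism
    [squash : r |-> r / (1 + |r|)] from the line onto ]-1, 1[ makes it bounded,
    so [squash \o f] extends to some [g], by C*-embedding.  The only obstacle to
    applying the inverse [unsquash] is the set where [1 <= |g|], which is the
    zero set of [max 0 (1 - |g|)].  A bound [|f| <= M] on a hard set gives
    [1 - |g| >= 1 / (1 + M)] there, so by hypothesis this zero set is completely
    separated from [T].  Multiplying [g] by a function [k] with values in [0, 1]
    that is [1] on [T] and [0] on the obstacle ([completely_separated_urysohn])
    gives [|g * k| < 1] everywhere, and [unsquash \o (g * k)] extends [f]. *)

(** The Stone-Cech compactification is Hausdorff, so points are closed in it and
    in each of its subspaces. *)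
Lemma hard_set1 (R : realType) (Y : topologicalType) (y : Y) : hard R [set y].
Proof.
rewrite /hard image_set1; apply: closed_subspaceW.
exact/accessible_closed_set1/hausdorff_accessible/stone_cech_hausdorff.
Qed.

(** If [A] and [B] lie in the disjoint zero sets of [p] and [q], then
    [|p| + |q|] never vanishes, and [|q| / (|p| + |q|)] is the required
    function. *)
Lemma completely_separated_urysohn (R : realType) (X : topologicalType)
    (A B : set X) : completely_separated R A B ->
  exists k : X -> R, [/\ continuous k, forall x, 0 <= k x <= 1,
    forall x, A x -> k x = 1 & forall x, B x -> k x = 0].
Proof.
move=> [p [q [cp cq Ap Bq pq0]]].
have D0 x : 0 < `|p x| + `|q x|.
  rewrite lt_neqAle addr_ge0// andbT eq_sym paddr_eq0// !normr_eq0.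
  apply/negP => /andP[/eqP px /eqP qx].
  by have : (zero_set p `&` zero_set q) x by []; rewrite pq0.
exists (fun x => `|q x| / (`|p x| + `|q x|)); split => [x|x|x /Ap px|x /Bq qx].
- apply: cvgM; first exact: cvg_norm (cq x).
  apply: cvgV; first exact: lt0r_neq0.
  by apply: cvgD; [exact: cvg_norm (cp x)|exact: cvg_norm (cq x)].
- by rewrite divr_ge0 ?(ltW (D0 x))//= ler_pdivrMr// mul1r lerDr.
- have := D0 x; rewrite (px : p x = 0) normr0 add0r => q0.
  by rewrite divff// lt0r_neq0.
- by rewrite (qx : q x = 0) normr0 mul0r.
Qed.

Lemma completely_separated_by (R : realType) (X : topologicalType)
    (A B : set X) (k : X -> R) : continuous k ->
  (forall x, A x -> k x = 1) -> (forall x, B x -> k x = 0) ->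
  completely_separated R A B.
Proof.
move=> ck A1 B0; exists (fun x => k x - 1), k; split => //.
- by move=> x; apply: cvgB; [exact: ck|exact: cvg_cst].
- by move=> x /A1; rewrite /zero_set /= => ->; rewrite subrr.
- apply/seteqP; split => // x [/=]; rewrite /zero_set /= => + k0.
  by rewrite k0 sub0r => /eqP; rewrite oppr_eq0 oner_eq0.
Qed.

Section Squash.
Context {R : realType}.
Implicit Types r : R.

Definition squash r := r / (1 + `|r|).
Definition unsquash r := r / (1 - `|r|).

Let add1_norm_gt0 r : 0 < 1 + `|r|.
Proof. by rewrite ltr_pwDl. Qed.

Lemma norm_squash r : `|squash r| = `|r| / (1 + `|r|).
Proof. by rewrite /squash normrM normfV (gtr0_norm (add1_norm_gt0 r)). Qed.

(** The distance from [squash r] to the ends of ]-1, 1[ is controlled by [|r|]: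
    this identity turns a bound on [r] into a bound away from zero. *)
Lemma subr1_norm_squash r : 1 - `|squash r| = (1 + `|r|)^-1.
Proof.
rewrite norm_squash -{1}(divff (lt0r_neq0 (add1_norm_gt0 r))) -mulrBl.
by rewrite addrK mul1r.
Qed.

Lemma norm_squash_lt1 r : `|squash r| < 1.
Proof. by rewrite -subr_gt0 subr1_norm_squash invr_gt0. Qed.

Lemma squashK r : unsquash (squash r) = r.
Proof.
by rewrite /unsquash subr1_norm_squash invrK divfK// lt0r_neq0.
Qed.

Lemma continuous_squash : continuous squash.
Proof.
move=> r; apply: cvgM; first exact: cvg_id.
apply: cvgV; first exact: lt0r_neq0.
by apply: cvgD; [exact: cvg_cst|exact: norm_continuous].
Qed.

Lemma continuous_unsquash r : `|r| < 1 -> {for r, continuous unsquash}.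
Proof.
move=> r1; apply: cvgM; first exact: cvg_id.
apply: cvgV; first by rewrite subr_eq0 gt_eqF.
by apply: cvgB; [exact: cvg_cst|exact: norm_continuous].
Qed.

End Squash.

Lemma continuous_restrict (R : realType) (X : topologicalType) (T : set X)
    (g : X -> R) : continuous g -> continuous (fun t : T => g (set_val t)).
Proof.
move=> cg t; apply: (@continuous_comp _ _ _ (set_val : T -> X) g).
  exact: initial_continuous.
exact: cg.
Qed.

Lemma continuous_inv (R : realType) (Y : topologicalType) (u : Y -> R) :
  continuous u -> (forall y, u y != 0) -> continuous (fun y => (u y)^-1).
Proof. by move=> cu u0 y; apply: cvgV; [exact: u0|exact: cu]. Qed.

Lemma S_embedded_separates (R : realType) (X : topologicalType) (T : set X)
    (g : X -> R) : S_embedded R T -> continuous g ->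
  (forall H : set T, hard R H -> bounded_away_from_zero g (set_val @` H)) ->
  completely_separated R T (zero_set g).
Proof.
move=> ST cg gH.
have g0 (t : T) : g (set_val t) != 0.
  have [m m0 mg] := gH _ (hard_set1 R T t).
  by rewrite -normr_gt0 (lt_le_trans m0)// mg//; exists t.
have [||h ch hE] := ST (fun t => (g (set_val t))^-1).
- exact: (continuous_inv _ _ _ (continuous_restrict _ _ _ _ cg) g0).
- move=> H /gH[m m0 mg]; exists m^-1; split; first by rewrite num_real.
  move=> M mM t Ht; apply: le_trans (ltW mM).
  rewrite normfV lef_pV2 ?posrE ?normr_gt0//.
  by apply: mg; exists t.
apply: (@completely_separated_by _ _ _ _ (fun x => g x * h x)).
- by move=> x; apply: cvgM; [exact: cg|exact: ch].
- move=> x Tx; have := hE (SigSub (mem_set Tx)).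
  have := g0 (SigSub (mem_set Tx)) => /= gx ->.
  by rewrite divff.
- by move=> x; rewrite /zero_set /= => ->; rewrite mul0r.
Qed.

Lemma Cstar_separates_S_embedded (R : realType) (X : topologicalType)
    (T : set X) : Cstar_embedded R T ->
  (forall g : X -> R, continuous g ->
    (forall H : set T, hard R H -> bounded_away_from_zero g (set_val @` H)) ->
    completely_separated R T (zero_set g)) ->
  S_embedded R T.
Proof.
move=> CT sep f cf bf.
have [||g cg gE] := CT (squash \o f).
- by move=> t; apply: (@continuous_comp _ _ _ f squash);
    [exact: cf|exact: continuous_squash].
- exists 1; split => // M M1 t _; apply: le_trans (ltW M1).
  exact/ltW/norm_squash_lt1.
(* The truncation at 0 makes the zero set of [z] the whole set where
   [1 <= |g|], and not only the set where [|g| = 1]. *)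
pose z x := Num.max 0 (1 - `|g x|).
have cz : continuous z.
  move=> x; apply: (@continuous_max _ _ (cst 0) (fun x => 1 - `|g x|)).
    exact: cvg_cst.
  by apply: cvgB; [exact: cvg_cst|exact: cvg_norm (cg x)].
have zH (H : set T) : hard R H -> bounded_away_from_zero z (set_val @` H).
  move=> /bf /ex_strict_bound_gt0[M M0 fM].
  exists (1 + M)^-1; first by rewrite invr_gt0 addr_gt0.
  move=> _ [t Ht <-]; rewrite ger0_norm ?le_max ?lexx// gE/= subr1_norm_squash.
  apply/orP; right; rewrite lef_pV2 ?posrE ?ltr_pwDl ?(ltW M0)//.
  by rewrite lerD2l ltW// fM.
have [k [ck k01 k1 k0]] := completely_separated_urysohn _ _ _ _ (sep z cz zH).
have gk1 x : `|g x * k x| < 1.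
  have [g1|g1] := leP 1 `|g x|.
    rewrite k0 ?mulr0 ?normr0// /zero_set /z /=.
    by apply/max_idPl; rewrite subr_le0.
  have /andP[k_ge0 k_le1] := k01 x.
  rewrite normrM (ger0_norm k_ge0); apply: le_lt_trans g1.
  by rewrite ler_piMr.
exists (fun x => unsquash (g x * k x)).
- move=> x.
  apply: (@continuous_comp _ _ _ (fun x => g x * k x) unsquash).
    by apply: cvgM; [exact: cg|exact: ck].
  exact: continuous_unsquash.
- by move=> t; rewrite gE k1 ?mulr1 ?squashK//; exact: set_valP.
Qed.

Theorem theorem4 (R : realType) (X : topologicalType) (T : set X) :
  tychonoff_space X ->
  Cstar_embedded R T ->
  S_embedded R T <->
  (forall g : X -> R, continuous g ->
    (forall H : set T, hard R H ->
      bounded_away_from_zero g (set_val @` H)) ->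
    completely_separated R T (zero_set g)).
Proof.
move=> _ CT; split => [ST g|]; first exact: S_embedded_separates.
exact: Cstar_separates_S_embedded.
Qed.
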